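(* Let $I\in\mathbb I$. (1) If $\sum_{k<\omega}2^{-|I_k|}<\infty$, then $\operatorname{non}(\mathcal M_I)\le\operatorname{non}(\mathcal E)$ and $\operatorname{cov}(\mathcal E)\le\operatorname{cov}(\mathcal M_I)$. (2) If $\sum_{k<\omega}2^{-|I_k|}=\infty$, then $\operatorname{cov}(\mathcal N)\le\operatorname{non}(\mathcal M_I)$ and $\operatorname{cov}(\mathcal M_I)\le\operatorname{non}(\mathcal N)$.
   Context: $\mathcal N$ is the ideal of Lebesgue measure zero subsets of ${}^\omega2$, and $\mathcal E$ is the $\sigma$-ideal generated by the closed measure zero subsets of ${}^\omega2$. $\forall^\infty n$ means ''for all but finitely many $n<\omega$''. $\mathbb I$ is the set of partitions $I=\langle I_n:n<\omega\rangle$ of $\omega$ into consecutive nonempty (finite) intervals. For $I,J\in\mathbb I$ and $y\in{}^\omega2$, $$A^I_{J,y}:=\{x\in{}^\omega2:\forall^\infty n<\omega\ \exists k<\omega\colon I_k\subseteq J_n\text{ and }x{\upharpoonright}I_k=y{\upharpoonright}I_k\},$$ and $\mathcal M_I:=\{X\subseteq{}^\omega2:\exists (J,y)\in\mathbb I\times{}^\omega2\colon X\subseteq A^I_{J,y}\}$, which is a $\sigma$-ideal on ${}^\omega2$. For an ideal $\mathcal I$ on ${}^\omega2$: $\operatorname{cov}(\mathcal I)$ is the least size of $\mathcal J\subseteq\mathcal I$ with $\bigcup\mathcal J={}^\omega2$; $\operatorname{non}(\mathcal I)$ is the least size of $A\subseteq{}^\omega2$ with $A\notin\mathcal I$. 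*)

(* Defs.v *)
From HB Require Import structures.
From mathcomp Require Import all_boot all_order all_algebra.
From mathcomp Require Import all_classical all_reals all_analysis.

Set Implicit Arguments.
Unset Strict Implicit.
Unset Printing Implicit Defensive.

Import Order.TTheory GRing.Theory Num.Theory.

Local Open Scope classical_set_scope.
Local Open Scope card_scope.
Local Open Scope ring_scope.

(* A partition of nat into consecutive nonempty finite intervals is given by
   the increasing sequence of the left endpoints of its blocks. *)
Record interval_partition := IntervalPartition {
  left_end : nat -> nat;
  left_end0 : left_end 0%N = 0%N;
  left_end_lt : forall n, (left_end n < left_end n.+1)%N }.

Definition block (I : interval_partition) (n : nat) : seq nat :=
  index_iota (left_end I n) (left_end I n.+1).

Definition A_set (I J : interval_partition) (y : cantor_space) :
    set cantor_space :=
  [set x : cantor_space | \forall n \near \oo, exists k : nat,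
     {subset block I k <= block J n} /\ {in block I k, x =1 y}].

Definition M_ideal (I : interval_partition) : set (set cantor_space) :=
  [set X | exists (J : interval_partition) (y : cantor_space),
     X `<=` A_set I J y].

Definition cylinder (s : seq bool) : set cantor_space :=
  [set x : cantor_space | forall i, (i < size s)%N -> x i = nth false s i].

(* The Lebesgue outer measure of the fair-coin product measure, which gives
   [cylinder s] measure 2^-(size s). *)
Definition cantor_outer_measure (R : realType) (X : set cantor_space) : \bar R :=
  ereal_inf [set (\sum_(0 <= i <oo) (2 ^- size (s i))%:E)%E |
    s in [set s : nat -> seq bool | X `<=` \bigcup_i cylinder (s i)]].

Definition N_ideal (R : realType) : set (set cantor_space) :=
  [set X | cantor_outer_measure R X = 0%E].

Definition sigma_ideal (T : Type) (I : set (set T)) : Prop :=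
  [/\ I set0,
      forall X Y : set T, X `<=` Y -> I Y -> I X &
      forall F : nat -> set T, (forall n, I (F n)) -> I (\bigcup_n F n)].

Definition E_ideal (R : realType) : set (set cantor_space) :=
  smallest (@sigma_ideal cantor_space)
    [set X | closed X /\ N_ideal R X].

(* Cardinals are represented by sets of that cardinality and compared with
   [#<=]: [least_size F] is a member of [F] of least cardinality, which exists
   as soon as [F] is nonempty by [least_sizeP]. *)
Definition least_size (T : Type) (F : set (set T)) : set T :=
  xget set0 [set A | F A /\ forall B, F B -> A #<= B].

Lemma least_sizeP (T : pointedType) (F : set (set T)) : F !=set0 ->
  F (least_size F) /\ forall B, F B -> least_size F #<= B.
Proof.
move=> [A0 FA0]; rewrite /least_size.
case: xgetP => [//|noleast]; exfalso.
pose P (S : set (set T -> T)) :=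
  (forall g, S g -> forall A, F A -> A (g A)) /\
  (forall g h, S g -> S h -> forall A, F A -> g A = h A -> g = h).
have [] := @Zorn_bigcup _ P.
  move=> C CP Ctot; split=> [g [S CS Sg]|g h [S CS Sg] [S' CS' Sh]].
    exact: ((CP _ CS).1 g Sg).
  have [SS'|S'S] := Ctot _ _ CS CS'.
    by move=> A; apply: (CP _ CS').2 => //; exact: SS'.
  by move=> A; apply: (CP _ CS).2 => //; exact: S'S.
move=> S [[Sch Sinj] Smax].
have evB (B : set T) : F B -> S #<= B.
  move=> FB; have /card_eqPle[_ SB] : (fun g => g B) @` S #= S.
    apply: inj_card_eq => g h; rewrite !inE => Sg Sh.
    exact: Sinj.
  apply: card_le_trans SB _; apply: subset_card_le => _ [g Sg <-].
  exact: (Sch g Sg B FB).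
have miss (A : set T) : exists a,
    F A -> A a /\ forall g, S g -> g A <> a.
  have [FA|nFA] := pselect (F A); last by exists point.
  apply: contrapT => noa; apply: (noleast A); split=> // B FB.
  apply: card_le_trans (evB _ FB).
  suff -> : A = (fun g => g A) @` S by exact: card_image_le.
  rewrite eqEsubset; split=> [a Aa|_ [g Sg <-]]; last first.
    exact: (Sch g Sg A FA).
  apply: contrapT => na; apply: noa; exists a => _; split=> // g Sg ga.
  by apply: na; exists g.
have [g gP] := choice miss.
have nSg : ~ S g by move=> Sg; apply: ((gP _ FA0).2 _ Sg).
have Sg : S `<` (g |` S).
  by split=> [h Sh|/(_ g (or_introl erefl))//]; right.
apply: (Smax _ Sg); split=> [h [->|Sh] A FA|h k].
- exact: (gP A FA).1.
- exact: (Sch h Sh A FA).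
- move=> [->|Sh] [->|Sk] A FA // e.
  + by have := (gP _ FA).2 _ Sk (esym e).
  + by have := (gP _ FA).2 _ Sh e.
  + exact: Sinj e.
Qed.

Definition cov (I : set (set cantor_space)) : set (set cantor_space) :=
  least_size [set J | J `<=` I /\ \bigcup_(X in J) X = setT].

Definition non (I : set (set cantor_space)) : set cantor_space :=
  least_size [set A | ~ I A].

(* Main.v *)
Require Import Defs.
From mathcomp Require Import all_boot all_order all_algebra.
From mathcomp Require Import all_classical all_reals all_analysis.

Set Implicit Arguments.
Unset Strict Implicit.
Unset Printing Implicit Defensive.

Import Order.TTheory GRing.Theory Num.Theory.

Local Open Scope classical_set_scope.
Local Open Scope card_scope.
Local Open Scope ring_scope.

(** Write [p k = 2^-|I_k|]: this is the probability that a random point agrees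
    on the block [I_k] with a given one.  If the series of the [p k] converges,
    agreement on some late block is unlikely, and all sets [A_set I J y] are
    null; if it diverges, agreement on one of many blocks is almost certain,
    since blocks are independent, and some [A_set I J y] have full measure.

    Convergent case.  [A_set I J y] is the increasing union over [m] of the sets
    [C m] of those [x] that agree with [y] on a block of [I] inside [J_n] for
    every [n >= m].  Each [C m] is closed, being an intersection of conditions
    on finitely many coordinates.  It is null: a block of [I] inside [J_n] has
    large index when [n] is large, so the measure of [C m] is at most every
    tail of the series.  Hence every member of [M_ideal I] belongs to [E_ideal]
    ([M_ideal_sub_E_ideal]), and both inequalities follow because [non] is
    monotone and [cov] antitone in the ideal ([non_le], [cov_le]).

    Divergent case.  The product of the [1 - p k] over [a <= k < b] tends to [0]
    as [b] grows, so the blocks of [I] can be grouped into a partition [J] for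
    which a random pair of points disagrees on all blocks of [I] inside [J_n]
    with probability at most [2^-(n+1)].  By Borel-Cantelli, for every [x] the
    relation [x \in A_set I J y] holds for almost all [y]
    ([exists_partition_N_ideal]).  For this single [J] the relation is a Tukey
    connection.  If [X] is not in [M_ideal I], then no [A_set I J y] contains
    [X], so the null sets [[set y | ~ A_set I J y x]], [x] in [X], cover the
    space; and if [Y] is not null, then every [x] lies in [A_set I J y] for some
    [y] in [Y], so these members of [M_ideal I] cover the space.  Both
    halves are instances of [cov_le_non].

    The invariant [non] is meaningful only for ideals that omit the whole space.
    For the null ideal this is [outer_measure_setT_ge1], and it passes to
    [E_ideal] since [E_ideal] is contained in the null ideal. *)

(** * Powers of one half *)

Lemma half_pow_le (R : realType) (e : R) : 0 < e -> exists p, 2 ^- p <= e.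
Proof.
move=> e0; have [p _ pe] := @near_infty_natSinv_expn_lt R (PosNum e0).
by exists p; have /= := pe p (leqnn p); rewrite div1r => /ltW.
Qed.

Lemma half_pow_ge0 (R : realType) n : 0 <= 2 ^- n :> R.
Proof. by rewrite invr_ge0 exprn_ge0. Qed.

(** * Interval partitions *)

Lemma left_end_le (I : interval_partition) k l :
  (k <= l)%N -> (left_end I k <= left_end I l)%N.
Proof.
by apply: (homo_leq leqnn leq_trans) => n; apply: ltnW (left_end_lt I n).
Qed.

Lemma left_end_ltn (I : interval_partition) k l :
  (k < l)%N -> (left_end I k < left_end I l)%N.
Proof. by move=> kl; apply: leq_trans (left_end_lt I k) (left_end_le I kl). Qed.

Lemma leq_left_end (J : interval_partition) n : (n <= left_end J n)%N.
Proof. by elim: n => // n IH; apply: leq_ltn_trans IH (left_end_lt J n). Qed.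

(** * The outer measure on Cantor space *)

Section CantorOuterMeasure.
Variable R : realType.
Local Notation mu := (cantor_outer_measure R).
Implicit Types (X Y : set cantor_space) (s w : seq bool) (L : seq (seq bool)).

Let half_powE_ge0 n : (0 <= (2 ^- n : R)%:E)%E.
Proof. by rewrite lee_fin half_pow_ge0. Qed.

Lemma outer_measure_le_cover X (s : nat -> seq bool) :
  X `<=` \bigcup_i cylinder (s i) ->
  (mu X <= \sum_(0 <= i <oo) (2 ^- size (s i))%:E)%E.
Proof. by move=> Xs; apply: ereal_inf_lbound; exists s. Qed.

Lemma outer_measure_lt_cover X (c : \bar R) : (mu X < c)%E ->
  exists2 s : nat -> seq bool, X `<=` \bigcup_i cylinder (s i) &
    (\sum_(0 <= i <oo) (2 ^- size (s i))%:E < c)%E.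
Proof. by move/ereal_inf_lt => [_ [s Xs <-] ?]; exists s. Qed.

Lemma outer_measure_ge0 X : (0 <= mu X)%E.
Proof.
apply: le_ereal_inf_tmp => _ [s _ <-].
by apply: nneseries_ge0 => i _ _.
Qed.

Lemma le_outer_measure X Y : X `<=` Y -> (mu X <= mu Y)%E.
Proof.
move=> XY; apply: le_ereal_inf_tmp => _ [s Ys <-].
by apply: outer_measure_le_cover; apply: subset_trans Ys.
Qed.

(** Countable subadditivity, with real upper bounds [w n] in place of the
    measures themselves, so that near-optimal covers exist without a finiteness
    side condition.  The cover of [F n] is allowed an excess of
    [e / 2^(n+1)]. *)
Lemma outer_measure_bigcup_le (F : nat -> set cantor_space) (w : nat -> R) :
  (forall n, (mu (F n) <= (w n)%:E)%E) ->
  (mu (\bigcup_n F n) <= \sum_(0 <= n <oo) (w n)%:E)%E.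
Proof.
move=> Fw; apply/lee_addgt0Pr => e e0.
have w0 n : (0 <= (w n)%:E)%E by apply: le_trans (outer_measure_ge0 _) (Fw n).
have /choice[s sP] : forall n, exists s : nat -> seq bool,
    F n `<=` \bigcup_i cylinder (s i) /\
    (\sum_(0 <= i <oo) (2 ^- size (s i))%:E
       <= (w n)%:E + (e / (2 ^ n.+1)%:R)%:E)%E.
  move=> n.
  have /outer_measure_lt_cover[s Fs /ltW sw] :
      (mu (F n) < (w n)%:E + (e / (2 ^ n.+1)%:R)%:E)%E.
    apply: le_lt_trans (Fw n) _.
    by rewrite -EFinD lte_fin ltrDl divr_gt0 // ltr0n expn_gt0.
  by exists s.
have /card_set_bijP[f fbij] : [set: nat] #= [set: nat * nat].
  by rewrite card_eq_sym; exact: card_nat2.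
apply: (@le_trans _ _ (\sum_(0 <= j <oo)
    (2 ^- size (s (f j).1 (f j).2) : R)%:E)%E).
  apply: outer_measure_le_cover => x [n _ /(sP n).1[i _ xni]].
  have [_ _ /(_ (n, i) I)[j _ fj]] := fbij.
  by exists j => //; rewrite fj.
apply: le_trans (epsilon_trick xpredT w0 (ltW e0)).
rewrite nneseries_esumT; last by move=> j; exact: half_powE_ge0.
rewrite -(@reindex_esum _ _ _ _ _ f
  (fun p => (2 ^- size (s p.1 p.2))%:E) fbij).
have -> : [set: nat * nat] = [set: nat] `*`` (fun=> [set: nat]).
  by rewrite predeqE.
rewrite -(esum_esum (a := fun n i => (2 ^- size (s n i))%:E)); last first.
  by move=> *; exact: half_powE_ge0.
rewrite -nneseries_esumT; last by move=> n; apply: esum_ge0.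
apply: lee_nneseries => [n _ _|n _]; first exact: esum_ge0.
by rewrite -nneseries_esumT; [exact: (sP n).2 | move=> i; exact: half_powE_ge0].
Qed.

Definition weight L : R := \sum_(s <- L) 2 ^- size s.

(** The outer measure is defined from infinite sequences of cylinders, so a
    finite list has to be padded; the padding words get longer and longer and
    have total measure at most [2^-p], with [p] arbitrary. *)
Lemma outer_measure_words L X :
  (forall x, X x -> exists2 s, s \in L & cylinder s x) ->
  (mu X <= (weight L)%:E)%E.
Proof.
move=> XL; apply/lee_addgt0Pr => e e0.
have [p pe] := half_pow_le e0.
(* Beyond the end of [L] the default value supplies the padding word, whose
   measure [2^-(p+i+1)] is the [i]-th term of a series of sum [2^-p]. *)
pose s i := nth (nseq (p + i.+1) false) L i.
apply: (@le_trans _ _ (\sum_(0 <= i <oo) (2 ^- size (s i))%:E)%E).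
  apply: outer_measure_le_cover => x /XL[w wL xw].
  by exists (index w L) => //; rewrite /s nth_index.
pose a i : R := if (i < size L)%N then 2 ^- size (nth [::] L i) else 0.
have a0 i : (0 <= (a i)%:E)%E.
  by rewrite /a; case: ifP => // _; exact: half_powE_ge0.
have -> : (weight L)%:E = (\sum_(0 <= i <oo) (a i)%:E)%E.
  rewrite (nneseries_split 0 (size L)) // add0n eseries0 ?adde0; last first.
    by move=> i /= Li _; rewrite /a ltnNge Li.
  rewrite /weight (big_nth [::]) sumEFin !big_nat; congr (_%:E).
  by apply: eq_bigr => i /andP[_ iL]; rewrite /a iL.
have p0 := half_pow_ge0 R p.
apply: (@le_trans _ _ (\sum_(0 <= i <oo) (a i)%:E + (2 ^- p)%:E)%E); last first.
  by rewrite leeD2l // lee_fin.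
apply: le_trans (epsilon_trick xpredT a0 p0).
apply: lee_nneseries => [i _ _|i _]; first exact: half_powE_ge0.
rewrite -EFinD lee_fin /a /s natrX.
have [iL|Li] := ltnP i (size L).
  by rewrite (set_nth_default [::]) // lerDl divr_ge0 // exprn_ge0.
by rewrite nth_default // size_nseq exprD invfM add0r.
Qed.

(** * Proper ideals *)

(** A greedy argument.  If the cylinders [s i] had
    total measure less than [1], then a word [w] could be extended bit by bit
    while keeping the total measure of the cylinders included in [cylinder w]
    below that of [cylinder w]: the two one-bit extensions of [w] share that
    total.  The branch built in this way lies in no cylinder [s i], because
    [s i], as one of its initial words, would violate the invariant. *)
Lemma outer_measure_setT_ge1 : (1 <= mu setT)%E.
Proof.
apply: le_ereal_inf_tmp => _ [s sT <-]; rewrite leNgt; apply/negP => s1.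
pose f w i : \bar R := if prefix w (s i) then (2 ^- size (s i))%:E else 0%E.
have f0 w i : (0 <= f w i)%E by rewrite /f; case: ifP.
pose tail w : \bar R := (\sum_(0 <= i <oo) f w i)%E.
have tail_split w : (tail (rcons w false) + tail (rcons w true) <= tail w)%E.
  rewrite /tail -nneseriesD => [|i _ _|i _ _]; [|exact: f0|exact: f0].
  apply: lee_nneseries => [i _ _|i _]; first exact: adde_ge0.
  rewrite /f; case: prefixP => [[t ->]|_]; last first.
    rewrite add0e; case: prefixP => [[t ->]|_]; last by case: ifP.
    by rewrite cat_rcons prefix_prefix.
  rewrite cat_rcons prefix_prefix.
  case: prefixP => [[t']|]; last by rewrite adde0.
  by rewrite cat_rcons => /(congr1 (drop (size w))); rewrite !drop_size_cat.
have /choice[g gP] : forall w, exists b, (tail w < (2 ^- size w)%:E)%E ->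
    (tail (rcons w b) < (2 ^- size (rcons w b))%:E)%E.
  move=> w; apply: contrapT => nob.
  have ge b : ((2 ^- (size w).+1)%:E <= tail (rcons w b))%E.
    rewrite leNgt; apply/negP => lt; apply: nob; exists b => _.
    by rewrite size_rcons.
  apply: nob; exists true => tw; exfalso; move: (tw).
  rewrite ltNge => /negP; apply; apply: le_trans (tail_split w).
  apply: le_trans (leeD (ge false) (ge true)).
  rewrite -EFinD lee_fin exprS invfM -mulrDl.
  by rewrite -[2^-1]div1r -splitr mul1r.
pose W n := iter n (fun w => rcons w (g w)) [::].
pose x : cantor_space := fun n => g (W n).
have Wx n : W n = mkseq x n by elim: n => // n IH; rewrite mkseqS -IH.
have Wtail n : (tail (W n) < (2 ^- size (W n))%:E)%E.
  elim: n => [|n /gP //]; rewrite expr0 invr1; apply: le_lt_trans s1.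
  apply: lee_nneseries => [i _ _|i _]; first exact: f0.
  by rewrite /f prefix0s.
have [i _ xi] := sT x I.
have sW : s i = W (size (s i)).
  rewrite Wx; apply: (@eq_from_nth _ false); rewrite ?size_mkseq // => j js.
  by rewrite nth_mkseq // xi.
have := Wtail (size (s i)); rewrite -sW ltNge => /negP; apply.
rewrite /tail (nneseriesD1 (n := i)) // /f prefix_refl.
by rewrite leeDl //; apply: nneseries_ge0 => k _ _; case: ifP.
Qed.

Lemma N_idealP X : N_ideal R X <-> (mu X <= 0)%E.
Proof.
split=> [->//|X0]; apply/eqP.
by rewrite eq_le X0 outer_measure_ge0.
Qed.

Lemma N_ideal_setT : ~ N_ideal R setT.
Proof.
move=> /N_idealP/(le_trans outer_measure_setT_ge1).
by rewrite lee_fin ler10.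
Qed.

Lemma sigma_ideal_N_ideal : sigma_ideal (N_ideal R).
Proof.
split.
- apply/N_idealP; have -> : 0%E = (weight [::])%:E by rewrite /weight big_nil.
  exact: outer_measure_words.
- move=> X Y XY /N_idealP Y0; apply/N_idealP.
  exact: le_trans (le_outer_measure XY) Y0.
- move=> F F0; apply/N_idealP.
  have := @outer_measure_bigcup_le F (fun=> 0).
  by rewrite eseries0 //; apply=> n; apply/N_idealP.
Qed.

Lemma sigma_ideal_E_ideal : sigma_ideal (E_ideal R).
Proof.
split.
- by move=> S [[S0 _ _] _].
- move=> X Y XY EY S SP; have [[_ Ssub _] _] := SP.
  exact: Ssub XY (EY S SP).
- move=> F EF S SP; have [[_ _ Scup] _] := SP.
  by apply: Scup => n; exact: EF n S SP.
Qed.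

Lemma E_ideal_sub_N_ideal : E_ideal R `<=` N_ideal R.
Proof.
by apply: smallest_sub; [exact: sigma_ideal_N_ideal | move=> X []].
Qed.

(** * Independence of disjoint blocks, by counting words *)

Definition words n : seq (seq bool) :=
  [seq val t | t <- enum {: n.-tuple bool}].

Lemma mem_words s : s \in words (size s).
Proof. by apply/mapP; exists (in_tuple s); rewrite ?mem_enum. Qed.

Lemma weight_words n : weight (words n) = 1.
Proof.
rewrite /weight big_map big_enum /=.
rewrite (eq_bigr (fun=> 2 ^- n)) => [|t _]; last first.
  by rewrite size_tuple.
by rewrite sumr_const card_tuple card_bool -[_ *+ _]mulr_natr natrX mulVf //.
Qed.

Lemma weight_rem_word s : weight (rem s (words (size s))) = 1 - 2 ^- size s.
Proof.
have := weight_words (size s).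
rewrite /weight (big_rem s (mem_words s)) /= => /(canRL (addKr _))->.
by rewrite addrC.
Qed.

(** This is the independence of events that depend on disjoint intervals of
    coordinates. *)
Lemma weight_allpairs_cat L1 L2 :
  weight [seq u ++ v | u <- L1, v <- L2] = weight L1 * weight L2.
Proof.
rewrite /weight big_allpairs_dep big_distrlr /=.
by apply: eq_bigr => u _; apply: eq_bigr => v _; rewrite size_cat exprD invfM.
Qed.

Lemma mem_cylinder_mkseq (x : cantor_space) n : cylinder (mkseq x n) x.
Proof. by move=> i; rewrite size_mkseq => ?; rewrite nth_mkseq. Qed.

Lemma mkseq_cat_index_iota (x : cantor_space) a b : (a <= b)%N ->
  mkseq x b = mkseq x a ++ map x (index_iota a b).
Proof. by move=> ab; rewrite /mkseq -map_cat -{2}[a]add0n -iotaD subnKC. Qed.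

(** The event is covered by the words that are free before the block and equal
    to [y] on it. *)
Lemma outer_measure_match (I : interval_partition) (y : cantor_space) k :
  (mu [set x : cantor_space | {in block I k, x =1 y}]
    <= (2 ^- size (block I k))%:E)%E.
Proof.
set w := map y (block I k).
have -> : 2 ^- size (block I k)
    = weight [seq u ++ v | u <- words (left_end I k), v <- [:: w]].
  by rewrite weight_allpairs_cat weight_words mul1r /weight big_seq1 size_map.
apply: outer_measure_words => x xy; exists (mkseq x (left_end I k.+1)).
  rewrite (mkseq_cat_index_iota x (ltnW (left_end_lt I k))); apply: allpairs_f.
    by rewrite -{2}(size_mkseq x (left_end I k)) mem_words.
  by rewrite inE; apply/eqP/eq_in_map.
exact: mem_cylinder_mkseq.
Qed.

(** The blocks are treated one at a time: the admissible words up to the end of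
    block [b] are those up to its beginning, followed by any word on the block
    except the restriction of [x]. *)
Lemma outer_measure_no_match (I : interval_partition) (x : cantor_space) a b :
  (a <= b)%N ->
  (mu [set y : cantor_space |
       forall k, (a <= k < b)%N -> ~ {in block I k, x =1 y}]
    <= (\prod_(a <= k < b) (1 - 2 ^- size (block I k)))%:E)%E.
Proof.
move=> ab.
suff [L <- LP] : exists2 L,
    weight L = \prod_(a <= k < b) (1 - 2 ^- size (block I k)) &
    forall y : cantor_space,
      (forall k, (a <= k < b)%N -> ~ {in block I k, x =1 y}) ->
      mkseq y (left_end I b) \in L.
  apply: outer_measure_words => y /LP yL.
  by exists (mkseq y (left_end I b)) => //; exact: mem_cylinder_mkseq.
elim: b ab => [|b IH].
  (* Coordinates before the first block considered are unconstrained. *)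
  rewrite leqn0 => /eqP->; exists (words (left_end I 0)).
    by rewrite weight_words big_geq.
  by move=> y _; rewrite -{2}(size_mkseq y (left_end I 0)) mem_words.
rewrite leq_eqVlt => /predU1P[->|]; last rewrite ltnS => ab.
  exists (words (left_end I b.+1)); first by rewrite weight_words big_geq.
  by move=> y _; rewrite -{2}(size_mkseq y (left_end I b.+1)) mem_words.
have [L LE LP] := IH ab.
set w := map x (block I b).
exists [seq u ++ v | u <- L, v <- rem w (words (size w))].
  by rewrite weight_allpairs_cat LE weight_rem_word size_map big_nat_recr.
move=> y xy; rewrite (mkseq_cat_index_iota y (ltnW (left_end_lt I b))).
apply: allpairs_f.
  by apply: LP => k /andP[ak kb]; apply: xy; rewrite ak ltnW.
apply: rem_mem.
  apply/eqP => /eq_in_map yx; apply: (xy b); first by rewrite ab ltnSn.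
  by move=> i /yx.
by rewrite size_map -(size_map y) mem_words.
Qed.

End CantorOuterMeasure.

(** * The convergent case *)

Lemma closed_finitely_determined (D : set cantor_space) N :
  (forall x z : cantor_space,
    D x -> (forall i, (i < N)%N -> x i = z i) -> D z) ->
  closed D.
Proof.
move=> DN; rewrite -[D]setCK; apply: open_closedC; rewrite openE => x nDx.
have nbhs_agree : nbhs x [set z : cantor_space | forall i : 'I_N, z i = x i].
  apply: (filter_forall (F := nbhs x)) => i.
  have := @proj_continuous nat (fun=> bool) i x [set x i].
  by apply; exact: discrete_set1.
apply: filterS nbhs_agree => z zx Dz; apply: nDx; apply: (DN z) => // i iN.
exact: (zx (Ordinal iN)).
Qed.

Lemma M_ideal_sub_E_ideal (R : realType) (I : interval_partition) :
  (\sum_(0 <= k <oo) ((2 ^- size (block I k) : R)%:E) < +oo)%E ->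
  M_ideal I `<=` E_ideal R.
Proof.
move=> sum_fin X [J [y XA]].
pose D n := [set x : cantor_space | exists k : nat,
  {subset block I k <= block J n} /\ {in block I k, x =1 y}].
pose C m := \bigcap_(n in [set n | (m <= n)%N]) D n.
have [_ Esub Ecup] := sigma_ideal_E_ideal R.
apply: (Esub _ (\bigcup_m C m)).
  by move=> x /XA[m _ xm]; exists m => // n; exact: xm.
apply: Ecup => m; apply: sub_gen_smallest; split.
  apply: closed_bigI => n _.
  apply: (@closed_finitely_determined _ (left_end J n.+1)).
  move=> x z [k [IJ xy]] xz; exists k; split=> // i ik.
  rewrite -xz ?xy //.
  by have := IJ i ik; rewrite mem_index_iota => /andP[].
apply/N_idealP.
have p0 k : (0 <= (2 ^- size (block I k) : R)%:E)%E.
  by rewrite lee_fin half_pow_ge0.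
have tail0 := nneseries_tail_cvg sum_fin (fun k _ => p0 k).
apply: (cvge_to_ge tail0); apply: nearW => N.
rewrite -nneseries_addn //; apply: le_trans; last first.
  by apply: outer_measure_bigcup_le => i; exact: outer_measure_match.
apply: le_outer_measure => x Cx.
(* As [left_end I N <= n <= left_end J n], the blocks of [I] inside [J_n] start
   at [left_end I N] or later, so they have index at least [N]. *)
have [k [IJ xy]] := Cx (maxn m (left_end I N)) (leq_maxl _ _).
have Nk : (N <= k)%N.
  rewrite leqNgt; apply/negP => kN.
  have := IJ (left_end I k); rewrite !mem_index_iota leqnn left_end_lt.
  move=> /(_ isT)/andP[+ _]; rewrite leqNgt => /negP; apply.
  apply: leq_trans (leq_left_end _ _); apply: leq_trans (leq_maxr _ _).
  exact: leq_trans (left_end_lt I k) (left_end_le I kN).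
by exists (k - N)%N => //=; rewrite subnK.
Qed.

(** The pointwise negation of [y] agrees with [y] on no block, since blocks are
    nonempty. *)
Lemma M_ideal_setT (I : interval_partition) : ~ M_ideal I setT.
Proof.
move=> [J [y /(_ (fun i => ~~ y i) Logic.I)[m _ /(_ m (leqnn m))[k [_]]]]].
move=> /(_ (left_end I k)); rewrite mem_index_iota leqnn left_end_lt.
by move=> /(_ isT); case: (y _).
Qed.

(** * The divergent case *)

Lemma prod_1B_le_expR (R : realType) (p : nat -> R) a b :
  (forall k, p k <= 1) ->
  \prod_(a <= k < b) (1 - p k) <= expR (- \sum_(a <= k < b) p k).
Proof.
move=> p1; rewrite -sumrN expR_sum; apply: ler_prod => k _.
by rewrite subr_ge0 p1 expR_ge1Dx.
Qed.

Lemma divergent_block_sum (R : realType) (p : nat -> R) a (C : R) :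
  (forall k, 0 <= p k) -> (\sum_(0 <= k <oo) (p k)%:E = +oo)%E ->
  exists2 b, (a < b)%N & C <= \sum_(a <= k < b) p k.
Proof.
move=> p0 poo; apply: contrapT => noC.
have lt_C b : (a < b)%N -> \sum_(a <= k < b) p k <= C.
  by move=> ab; rewrite leNgt; apply/negP => /ltW Cb; apply: noC; exists b.
have p0E k : (0 <= (p k)%:E)%E by rewrite lee_fin.
have tail_le : (\sum_(a <= k <oo) (p k)%:E <= C%:E)%E.
  apply: lime_le; first by apply: is_cvg_nneseries.
  by exists a.+1 => // b /= ab; rewrite sumEFin lee_fin lt_C.
move: poo; rewrite (nneseries_split 0 a) // add0n sumEFin => poo.
have := leeD2l (\sum_(0 <= k < a) p k)%:E tail_le.
by rewrite poo -EFinD leNgt ltry.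
Qed.

Lemma block_product_le (R : realType) (p : nat -> R) a n :
  (forall k, 0 <= p k <= 1) -> (\sum_(0 <= k <oo) (p k)%:E = +oo)%E ->
  exists2 b, (a < b)%N & \prod_(a <= k < b) (1 - p k) <= 2 ^- n.
Proof.
move=> p01 poo.
have [|b ab nb] := @divergent_block_sum _ p a n%:R _ poo.
  by move=> k; have /andP[] := p01 k.
exists b => //; apply: le_trans.
  by apply: prod_1B_le_expR => k; have /andP[] := p01 k.
(* It remains to see that [2 ^+ n <= expR n], as [2 <= expR 1]. *)
rewrite expRN lef_pV2 ?posrE ?expR_gt0 ?exprn_gt0 //.
apply: (@le_trans _ _ (expR n%:R)); last by rewrite ler_expR.
rewrite -[n%:R]mulr1 expRM_natl lerXn2r ?nnegrE ?expR_ge0 //.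
by have := expR_ge1Dx (1 : R).
Qed.

(** The partition [J] groups the blocks of [I] with indices in
    [[c n, c n.+1)], where [c n.+1] is taken so large that disagreement on all
    of them has probability at most [2^-(n+1)].  If [x] is outside
    [A_set I J y], such a disagreement happens for some [n >= m], for every [m],
    and the sum of the bounds over [n >= m] is [2^-m]. *)
Lemma exists_partition_N_ideal (R : realType) (I : interval_partition) :
  (\sum_(0 <= k <oo) ((2 ^- size (block I k) : R)%:E) = +oo)%E ->
  exists J, forall x : cantor_space, N_ideal R [set y | ~ A_set I J y x].
Proof.
move=> sum_oo.
have p01 k : 0 <= (2 ^- size (block I k) : R) <= 1.
  by rewrite half_pow_ge0 /= invf_le1 ?exprn_gt0 // exprn_ege1 // ler1n.
have /choice[next nextP] : forall q : nat * nat, exists b, (q.1 < b)%N /\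
    \prod_(q.1 <= k < b) (1 - 2 ^- size (block I k)) <= (2 ^- q.2.+1 : R).
  move=> [a n].
  by have [b ab ?] := block_product_le a n.+1 p01 sum_oo; exists b.
pose c := fix c n := if n is m.+1 then next (c m, m) else 0%N.
have c_lt n : (left_end I (c n) < left_end I (c n.+1))%N.
  exact: left_end_ltn (nextP (c n, n)).1.
exists (@IntervalPartition (left_end I \o c) (left_end0 I) c_lt) => x.
apply/N_idealP/lee_addgt0Pr => e /half_pow_le[m me]; rewrite add0e.
apply: (@le_trans _ _ (2 ^- m)%:E); last by rewrite lee_fin.
apply: le_trans (epsilon_trick0 xpredT (half_pow_ge0 R m)).
pose F i := [set y : cantor_space | forall k,
  (c (i + m) <= k < c (i + m).+1)%N -> ~ {in block I k, x =1 y}].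
apply: (@le_trans _ _ (cantor_outer_measure R (\bigcup_i F i))).
  apply: le_outer_measure => y nA; apply: contrapT => nF; apply: nA.
  exists m => // n mn; apply: contrapT => nk; apply: nF.
  exists (n - m)%N => // k; rewrite subnK // => /andP[ck kc] xy.
  apply: nk; exists k; split=> // i; rewrite !mem_index_iota /= => /andP[ki ik].
  by rewrite (leq_trans (left_end_le I ck)) // (leq_trans ik) // left_end_le.
apply: outer_measure_bigcup_le => i.
have [/= /ltnW clt cprod] := nextP (c (i + m), i + m)%N.
apply: le_trans (outer_measure_no_match R I x clt) _.
by rewrite lee_fin (le_trans cprod) // natrX -addSn exprD invfM mulrC.
Qed.

(** * Comparison of the cardinal invariants *)

Lemma non_notin (I : set (set cantor_space)) : ~ I setT -> ~ I (non I).
Proof.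
by move=> IT; apply: (least_sizeP (F := [set A | ~ I A]) _).1; exists setT.
Qed.

Lemma non_le_card (I : set (set cantor_space)) (X : set cantor_space) :
  ~ I X -> non I #<= X.
Proof.
by move=> IX; apply: (least_sizeP (F := [set A | ~ I A]) _).2 => //; exists X.
Qed.

Lemma cov_le_card (I K : set (set cantor_space)) :
  K `<=` I -> \bigcup_(X in K) X = setT -> cov I #<= K.
Proof.
move=> KI KT; apply: (least_sizeP (T := set cantor_space)
  (F := [set K | K `<=` I /\ \bigcup_(X in K) X = setT]) _).2; last by split.
by exists K; split.
Qed.

Lemma cov_covers (I : set (set cantor_space)) : \bigcup_(X in I) X = setT ->
  cov I `<=` I /\ \bigcup_(X in cov I) X = setT.
Proof.
move=> IT; apply: (least_sizeP (T := set cantor_space)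
  (F := [set K | K `<=` I /\ \bigcup_(X in K) X = setT]) _).1.
by exists I; split.
Qed.

Lemma non_le (I J : set (set cantor_space)) :
  I `<=` J -> ~ J setT -> non I #<= non J.
Proof. by move=> IJ JT; apply: non_le_card => /IJ; exact: non_notin. Qed.

Lemma cov_le (I J : set (set cantor_space)) :
  I `<=` J -> \bigcup_(X in I) X = setT -> cov J #<= cov I.
Proof.
move=> IJ /cov_covers[cI cT].
by apply: cov_le_card => //; exact: subset_trans IJ.
Qed.

(** Half of a Tukey connection: [F] sends points to members of [I], and the
    values of [F] on a set outside [J] cover the space, since a point [y] missed
    by all of them would put that set below the member
    [[set x | ~ F x y]] of [J]. *)
Lemma cov_le_non (I J : set (set cantor_space))
    (F : cantor_space -> set cantor_space) :
  (forall X Y : set cantor_space, X `<=` Y -> J Y -> J X) -> ~ J setT ->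
  (forall x, I (F x)) -> (forall y, J [set x | ~ F x y]) ->
  cov I #<= non J.
Proof.
move=> Jsub JT IF JF.
apply: (@card_le_trans _ _ _ (F @` non J)); last exact: card_image_le.
apply: cov_le_card => [_ [x _ <-]//|].
rewrite -subTset => y _; apply: contrapT => nFy.
apply: (non_notin JT); apply: Jsub (JF y) => x nJx Fxy; apply: nFy.
by exists (F x) => //; exists x.
Qed.

Theorem theoremC (R : realType) (I : interval_partition) :
  ((\sum_(0 <= k <oo) ((2 ^- size (block I k) : R)%:E) < +oo)%E ->
     (non (M_ideal I) #<= non (E_ideal R)) /\
     (cov (E_ideal R) #<= cov (M_ideal I))) /\
  ((\sum_(0 <= k <oo) ((2 ^- size (block I k) : R)%:E) = +oo)%E ->
     (cov (N_ideal R) #<= non (M_ideal I)) /\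
     (cov (M_ideal I) #<= non (N_ideal R))).
Proof.
split=> [/M_ideal_sub_E_ideal ME|/exists_partition_N_ideal[J JN]]; split.
- apply: non_le ME _ => /E_ideal_sub_N_ideal; exact: N_ideal_setT.
- apply: cov_le ME _; rewrite -subTset => y _; exists [set y] => //.
  by exists I, y => _ ->; exists 0%N => // n _; exists n; split.
- apply: (cov_le_non (F := fun x => [set y | ~ A_set I J y x])) => //.
  + by move=> X Y XY [K [y YA]]; exists K, y; exact: subset_trans YA.
  + exact: M_ideal_setT.
  + by move=> y; exists J, y => x /contrapT.
- apply: (cov_le_non (F := fun y => A_set I J y)) => //.
  + by have [_] := sigma_ideal_N_ideal R.
  + exact: N_ideal_setT.
  + by move=> y; exists J, y.
Qed.
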